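(* A sequence $\mathbf b=(b_1,\dots,b_{k-1})$ of non-negative integers is admissible if and only if it is a matching sequence.
   Context: Fix an integer $k\ge 2$. For a sequence $\mathbf b=(b_1,\dots,b_{k-1})$ of non-negative integers write $|\mathbf b|=\sum_i b_i$. The bipartite graph $\mathcal B_{\mathbf b}$ has upper vertex class $U=\{(j,l):1\le j\le l\le k-1\}$ and lower vertex class $D_{\mathbf b}=\{(i,t):1\le i\le k-1,\ 1\le t\le b_i\}$, with an edge between $(j,l)\in U$ and $(i,t)\in D_{\mathbf b}$ if and only if $j\le i\le l$. The sequence $\mathbf b$ is a matching sequence if $\mathcal B_{\mathbf b}$ has a matching covering all of $D_{\mathbf b}$. The sequence $\mathbf b$ is admissible if for every choice of pairwise distinct integers $a_1,\dots,a_k$ and every choice of finite sets $M_1,\dots,M_{k-1}\subset\mathbb Z$ with $|M_i|=b_i$, there is a permutation $\pi\in S_k$ with $\sum_{j=1}^i a_{\pi(j)}\notin M_i$ for all $1\le i\le k-1$. *)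

(* Defs.v *)
From mathcomp Require Import all_boot all_order all_algebra all_fingroup.
Set Implicit Arguments. Unset Strict Implicit. Unset Printing Implicit Defensive.
Import GRing.Theory Num.Theory.

(* Indices are 0-based: the paper's index i in {1,...,k-1} is represented by
   i : 'I_k.-1 (value i-1).  A sequence b = (b_1,...,b_{k-1}) is a function
   b : 'I_k.-1 -> nat. *)

(* Upper vertex (j,l) with j <= l, lower vertex (i,t) with t < b i;
   edge iff j <= i <= l.  A matching covering D_b is an injective map
   from D_b to U sending each lower vertex to an adjacent upper vertex. *)
Definition matching_seq (k : nat) (b : 'I_k.-1 -> nat) : Prop :=
  exists f : forall i : 'I_k.-1, 'I_(b i) -> 'I_k.-1 * 'I_k.-1,
    (forall i (t : 'I_(b i)), (f i t).1 <= i <= (f i t).2)%N /\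
    (forall i1 (t1 : 'I_(b i1)) i2 (t2 : 'I_(b i2)),
        f i1 t1 = f i2 t2 -> i1 = i2 /\ (t1 : nat) = t2).

Definition admissible (k : nat) (b : 'I_k.-1 -> nat) : Prop :=
  forall (a : 'I_k -> int), injective a ->
  forall (M : 'I_k.-1 -> seq int),
    (forall i, uniq (M i) /\ size (M i) = b i) ->
  exists pi : 'S_k,
    forall i : 'I_k.-1,
      (\sum_(j < k | (j <= i)%N) a (pi j))%R \notin M i.

(* Main.v *)
Require Import Defs.
From mathcomp Require Import all_boot all_order all_algebra all_fingroup.
From HB Require Import structures.
From mathcomp Require Import zify ring.
From mathcomp.multinomials Require Import mpoly.
Set Implicit Arguments. Unset Strict Implicit. Unset Printing Implicit Defensive.
Import Order.TTheory GRing.Theory Num.Theory.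
Local Open Scope ring_scope.

(** Sufficiency.  For a polynomial P in x_1,...,x_k of degree at most k(k-1)/2, the
    signed sum of P over the rearrangements of a is V(a) (V = Vandermonde) times the
    constant sum_s sgn(s) [x^(s(delta))] P, and that constant is, up to sign and the
    factor prod_i i!, the result of applying the differential operator V(d/dx) to P.
    Take for P the product, over the upper vertices u = (j,l), of linear forms
    x_1+...+x_i - m, with i the index matched to u and m a forbidden value.  Since
    d/dx_j - d/dx_(l+1) sends x_1+...+x_i - m to 1 when j <= i <= l and to 0 otherwise,
    V(d/dx) P counts perfect matchings, so it is positive, and P cannot vanish at every
    rearrangement of a.

    Necessity.  If a set I of indices violates Hall's condition, take a = {0,...,k-1}
    and let M_i, for i in I, be an interval starting at the least i-th partial sum that
    the earlier M_p leave possible.  Avoiding M_i raises that least value by b_i;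
    passing from one element p of I to the next one, i, loses p(i-p) over the minimum,
    the number of intervals that meet I and have their right end in [p,i-1].  After the
    last element of I the partial sum exceeds its maximum. *)

(** * Sums of distinct natural numbers *)

Lemma uniq_max_geq (s : seq nat) : uniq s -> s != [::] ->
  exists2 x, x \in s & ((size s).-1 <= x)%N.
Proof.
move=> us s0; apply/hasP; apply/negPn/negP => /hasPn h.
have sub : {subset s <= iota 0 (size s).-1}.
  by move=> x /h; rewrite mem_iota -ltnNge.
have := uniq_leq_size us sub; rewrite size_iota.
by case: s s0 {us h sub} => //= x s _; rewrite ltnn.
Qed.

Lemma uniq_sumn_geq (s : seq nat) : uniq s -> ('C(size s, 2) <= sumn s)%N.
Proof.
have [m] := ubnP (size s); elim: m s => // m IHm s lt_s us.
have [->//|s0] := eqVneq s [::].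
have [x xs le_x] := uniq_max_geq us s0.
have := IHm (rem x s); rewrite rem_uniq // size_rem // => IH.
rewrite (perm_sumn (perm_to_rem xs)) /=.
have s_gt0 : (0 < size s)%N by case: (s) s0.
rewrite -(prednK s_gt0) binS bin1 /= in lt_s *.
by rewrite addnC leq_add // IH // -ltnS.
Qed.

(** An entry as large as the size, added to the least possible sum of the others, would exceed the
    bound. This will force distinct exponents of small total degree to be 0,...,n-1 in some
    order. *)
Lemma uniq_sumn_leq_ltn (s : seq nat) :
  uniq s -> (sumn s <= 'C(size s, 2))%N -> {in s, forall x, (x < size s)%N}.
Proof.
move=> us le_s x xs; rewrite ltnNge; apply: contraL le_s => le_x.
rewrite (perm_sumn (perm_to_rem xs)) /= -ltnNge.
have s_gt0 : (0 < size s)%N by case: (s) xs.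
have := uniq_sumn_geq (rem_uniq x us); rewrite size_rem // => le_rem.
by rewrite -[in 'C(size s, 2)](prednK s_gt0) binS bin1 -addnS prednK // addnC leq_add.
Qed.

(** * The differentiation pairing on polynomials *)

Section Pairing.
Variable n : nat.
Implicit Types (D P : {mpoly int[n]}) (m : 'X_{1..n}).

Definition mfact m : nat := (\prod_i (m i)`!)%N.

(* [mpair D P] is the constant coefficient of [D(d/dX) P]. *)
Definition mpair D P : int := \sum_(m <- msupp D) D@_m * P@_m * (mfact m)%:R.

(** The sum runs over one support only, but terms outside the common support vanish. *)
Lemma mpairC D P : mpair D P = mpair P D.
Proof.
have aux Q1 Q2 : mpair Q1 Q2 =
    \sum_(m <- [seq m <- msupp Q1 | m \in msupp Q2]) Q1@_m * Q2@_m * (mfact m)%:R.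
  rewrite big_filter /mpair big_mkcond [RHS]big_mkcond; apply: eq_bigr => m _ /=.
  by case: ifPn => // /memN_msupp_eq0 ->; rewrite mulr0 mul0r.
rewrite !aux (perm_big [seq m <- msupp P | m \in msupp D]) /=.
  by apply: eq_bigr => m _; rewrite [D@_m * _]mulrC.
apply: uniq_perm; rewrite ?filter_uniq ?msupp_uniq // => m.
by rewrite !mem_filter andbC.
Qed.

Lemma mpair_is_zmod_morphism D : zmod_morphism (mpair D).
Proof.
move=> P Q; rewrite /mpair -sumrB; apply: eq_bigr => m _.
by rewrite mcoeffB mulrBr mulrBl.
Qed.

HB.instance Definition _ D :=
  GRing.isZmodMorphism.Build {mpoly int[n]} int (mpair D) (@mpair_is_zmod_morphism D).

Lemma mpairZr D c P : mpair D (c *: P) = c * mpair D P.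
Proof.
rewrite /mpair mulr_sumr; apply: eq_bigr => m _.
by rewrite mcoeffZ !mulrA [D@_m * c]mulrC.
Qed.

Lemma mpairXr D m : mpair D 'X_[m] = D@_m * (mfact m)%:R.
Proof. by rewrite mpairC /mpair msuppX big_seq1 mcoeffX eqxx mul1r. Qed.

(** Adjointness: the exponent that the derivative brings down is the factor by which the factorial
    grows. *)
Lemma mpairMX D P (i : 'I_n) : mpair (D * 'X_i) P = mpair D P^`M(i).
Proof.
rewrite mpairC {1}[D]mpolyE mulr_suml raddf_sum; apply: eq_bigr => m _ /=.
rewrite -scalerAl -mpolyXD mpairZr mpairXr mcoeff_deriv -mulrA; congr (_ * _).
rewrite mulrnAl -mulrnAr; congr (_ * _).
rewrite -mulrnA; congr (_%:R).
rewrite /mfact (bigD1 i) //= [in RHS](bigD1 i) //= mnmDE mnm1E eqxx addn1 factS.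
rewrite -mulnA mulnC; congr (_ * _ * _)%N.
by apply: eq_bigr => j ji; rewrite mnmDE mnm1E eq_sym (negPf ji) addn0.
Qed.

Lemma mpair11 P : mpair 1 P = P@_0%MM.
Proof.
rewrite /mpair msupp1 big_seq1 mcoeff1 eqxx mul1r /mfact big1 ?mulr1 //.
by move=> i _; rewrite mnm0E.
Qed.

End Pairing.

(** * Signed sums over rearrangements and the Vandermonde product *)

Section Antisym.
Variable n : nat.
Implicit Types (P : {mpoly int[n]}) (a : 'I_n -> int).

(** Exponent vector of x^(s(delta)), where delta = (0,...,n-1). *)
Definition mnm_perm (s : 'S_n) : 'X_{1..n} := [multinom (s i : nat) | i < n].

Lemma vandermonde_leibniz (R : comPzRingType) (x : 'I_n -> R) :
  \prod_(i < n) \prod_(j < n | (i < j)%N) (x j - x i) =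
  \sum_(s : 'S_n) (-1) ^+ s * \prod_i x i ^+ s i.
Proof.
have := det_Vandermonde (\row_i x i); rewrite -det_tr /determinant => e.
transitivity (\prod_(i < n) \prod_(j < n | (i < j)%N) ((\row_i x i) 0 j - (\row_i x i) 0 i)).
  by apply: eq_bigr => i _; apply: eq_bigr => j _; rewrite !mxE.
rewrite -e; apply: eq_bigr => s _; congr (_ * _).
by apply: eq_bigr => i _; rewrite !mxE.
Qed.

(** Every monomial of the Leibniz expansion has exponents 0,...,n-1 in some order, so [mfact] takes
    the same value on all of them. *)
Lemma mpair_vandermonde P :
  mpair (\prod_(i < n) \prod_(j < n | (i < j)%N) ('X_j - 'X_i)) P =
  (\prod_(i < n) i`!)%:R * \sum_(s : 'S_n) (-1) ^+ s * P@_(mnm_perm s).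
Proof.
rewrite vandermonde_leibniz mpairC raddf_sum mulr_sumr; apply: eq_bigr => s _ /=.
have -> : (-1) ^+ s * \prod_i 'X_i ^+ s i = (-1) ^+ s *: 'X_[mnm_perm s] :> {mpoly int[n]}.
  rewrite [X in _ *: X]mpolyXE_id; under [in RHS]eq_bigr do rewrite mnmE.
  by rewrite mulr_sign scaler_sign.
rewrite mpairZr mpairXr [RHS]mulrCA; congr (_ * _); rewrite mulrC; congr (_%:R * _).
rewrite /mfact [RHS](reindex_inj (@perm_inj _ s)).
by apply: eq_bigr => i _; rewrite mnmE.
Qed.

Lemma injective_mnm_perm (m : 'X_{1..n}) :
  (mdeg m <= 'C(n, 2))%N -> injective m -> exists s, m = mnm_perm s.
Proof.
move=> le_m inj_m; pose l := [seq m i | i <- enum 'I_n].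
have ul : uniq l by rewrite map_inj_uniq ?enum_uniq.
have sl : size l = n by rewrite size_map size_enum_ord.
have lt_m i : (m i < n)%N.
  rewrite -[X in (_ < X)%N]sl; apply: uniq_sumn_leq_ltn => //.
    by rewrite sl (leq_trans _ le_m) // mdegE sumnE big_map big_enum.
  by rewrite map_f ?mem_enum.
have inj_f : injective (fun i => Ordinal (lt_m i)).
  by move=> i j [/inj_m].
by exists (perm inj_f); apply/mnmP => i; rewrite mnmE permE.
Qed.

(** The sum is a determinant with two equal rows. *)
Lemma sum_sign_prod_noninjective (m : 'X_{1..n}) a : ~ injective m ->
  \sum_(s : 'S_n) (-1) ^+ s * \prod_i a (s i) ^+ m i = 0.
Proof.
move=> ninj; pose A := \matrix_(i, j) a j ^+ m i.
have -> : \sum_(s : 'S_n) (-1) ^+ s * \prod_i a (s i) ^+ m i = \det A.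
  by apply: eq_bigr => s _; congr (_ * _); apply: eq_bigr => i _; rewrite mxE.
case: (boolP [exists i, exists j, (i != j) && (m i == m j)]) => [|/existsPn h].
  case/existsP=> i /existsP[j /andP[ij /eqP mij]].
  by apply: (determinant_alternate ij) => l; rewrite !mxE mij.
case: ninj => i j mij; apply/eqP; apply: contraT => ij.
by have /existsPn/(_ j) := h i; rewrite ij mij eqxx.
Qed.

Lemma sum_sign_prod_perm (t : 'S_n) a :
  \sum_(s : 'S_n) (-1) ^+ s * \prod_i a (s i) ^+ mnm_perm t i =
  (-1) ^+ t * \prod_(i < n) \prod_(j < n | (i < j)%N) (a j - a i).
Proof.
(* Substitute s = t * u^-1; reindexing the inner product by u * t^-1 then turns the base into [a i]
   and the exponent into [u i]. *)
rewrite vandermonde_leibniz mulr_sumr (reindex_inj (inj_comp (mulgI t) invg_inj)) /=.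
apply: eq_bigr => u _; rewrite mulrA -signr_addb odd_permM odd_permV; congr (_ * _).
rewrite (reindex_inj (@perm_inj _ (u * t^-1)%g)); apply: eq_bigr => i _.
by rewrite mnmE -!permM mulgKV -mulgA mulKg mulgV perm1.
Qed.

(** Expand [P] into monomials. Those with a repeated exponent cancel, and the degree bound leaves
    only the [mnm_perm s], each giving a signed Vandermonde product. *)
Lemma sum_sign_meval P a : (msize P <= 'C(n, 2).+1)%N ->
  \sum_(s : 'S_n) (-1) ^+ s * P.@[fun i => a (s i)] =
  (\sum_(s : 'S_n) (-1) ^+ s * P@_(mnm_perm s)) *
    \prod_(i < n) \prod_(j < n | (i < j)%N) (a j - a i).
Proof.
move=> szP; set V := \prod_(i < n) _.
have evP (s : 'S_n) : (-1) ^+ s * P.@[fun i => a (s i)] =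
    \sum_(m <- msupp P) P@_m * ((-1) ^+ s * \prod_i a (s i) ^+ m i).
  by rewrite mevalE mulr_sumr; apply: eq_bigr => m _; rewrite mulrCA.
rewrite (eq_bigr _ (fun s _ => evP s)) exchange_big /=.
pose A m := \sum_(s : 'S_n) (-1) ^+ s * \prod_i a (s i) ^+ m i.
rewrite (eq_bigr (fun m : 'X_{1..n} => P@_m * A m)); last by move=> m _; rewrite mulr_sumr.
pose I := [seq mnm_perm s | s <- enum [set: 'S_n]].
have uI : uniq I.
  rewrite map_inj_uniq ?enum_uniq // => s t /mnmP est; apply/permP => i.
  by apply: val_inj; have := est i; rewrite !mnmE.
transitivity (\sum_(m <- I) P@_m * A m); last first.
  rewrite big_map big_enum /= mulr_suml (eq_bigl xpredT) => [|s]; last by rewrite inE.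
  by apply: eq_bigr => s _; rewrite /A sum_sign_prod_perm mulrA; congr (_ * _); rewrite mulrC.
rewrite [RHS](bigID (mem (msupp P))) /= [X in _ + X]big1 ?addr0; last first.
  by move=> m /memN_msupp_eq0 ->; rewrite mul0r.
rewrite (bigID (mem I)) /= [X in _ + X]big_seq_cond [X in _ + X]big1 ?addr0; last first.
  move=> m /andP[mP mI]; rewrite /A sum_sign_prod_noninjective ?mulr0 // => inj_m.
  have le_m : (mdeg m <= 'C(n, 2))%N by rewrite -ltnS (leq_trans (msize_mdeg_lt mP)).
  have [s ms] := injective_mnm_perm le_m inj_m.
  by move/negP: mI; apply; rewrite ms map_f // mem_enum inE.
rewrite -[LHS]big_filter -[RHS]big_filter; apply: perm_big; apply: uniq_perm.
- by rewrite filter_uniq // msupp_uniq.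
- by rewrite filter_uniq.
by move=> m; rewrite !mem_filter andbC.
Qed.

End Antisym.

(** * Derivatives of prefix forms along roots, and matchings *)

Section Linear_forms.
Variable n : nat.
Implicit Types (u : 'I_n * 'I_n) (t : 'I_n * int) (s : seq ('I_n * 'I_n)) (T : seq ('I_n * int)).

Definition prefix_form t : {mpoly int[n.+1]} :=
  \sum_(j < n.+1 | (j <= t.1)%N) 'X_j - t.2%:MP.

(** The index [lift ord0 u.2] is u.2 + 1, so the pairs with u.1 <= u.2 in ['I_n] give all pairs i <
    j in ['I_n.+1]. *)
Definition root_form u : {mpoly int[n.+1]} :=
  'X_(widen_ord (leqnSn n) u.1) - 'X_(lift ord0 u.2).

Definition root_deriv u (P : {mpoly int[n.+1]}) :=
  P^`M(widen_ord (leqnSn n) u.1) - P^`M(lift ord0 u.2).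

Definition covers u t := (u.1 <= t.1 <= u.2)%N.

Lemma mpair_root D P u : mpair (D * root_form u) P = mpair D (root_deriv u P).
Proof.
by rewrite /root_form /root_deriv mulrBr mpairC !raddfB /= ![mpair P _]mpairC !mpairMX.
Qed.

Lemma mderiv_prefix_form i t : (prefix_form t)^`M(i) = (i <= t.1)%N%:R.
Proof.
rewrite /prefix_form mderivB mderivC subr0 raddf_sum /=.
have dX (j : 'I_n.+1) : ('X_j : {mpoly int[n.+1]})^`M(i) = (j == i)%:R.
  rewrite mderivX mnm1E; case: eqVneq => [->|_]; last by rewrite scale0r.
  have -> : (U_(i) - U_(i))%MM = 0%MM :> 'X_{1..n.+1}.
    by apply/mnmP => l; rewrite mnmBE subnn mnm0E.
  by rewrite scale1r mpolyX0.
under eq_bigr do rewrite dX.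
case: (leqP i t.1) => it; first by rewrite (bigD1 i) //= eqxx big1 ?addr0 // => j /andP[_ /negPf->].
by rewrite big1 // => j jt; case: eqVneq => // ji; rewrite ji leqNgt it in jt.
Qed.

Lemma root_deriv_prefix_form u t :
  (u.1 <= u.2)%N -> root_deriv u (prefix_form t) = (covers u t)%:R.
Proof.
rewrite /root_deriv !mderiv_prefix_form /covers lift0 /= => le_u.
by case: (leqP u.1 t.1) => ?; case: (leqP t.1 u.2) => ?; rewrite ?subrr ?subr0 //; lia.
Qed.

Lemma root_deriv_prod u T : (u.1 <= u.2)%N ->
  root_deriv u (\prod_(t <- T) prefix_form t) =
  \sum_(t <- T) (covers u t)%:R * \prod_(t' <- rem t T) prefix_form t'.
Proof.
move=> le_u; elim: T => [|t T IH].
  by rewrite !big_nil /root_deriv -[1]mpolyC1 !mderivC subrr.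
have -> : root_deriv u (\prod_(x <- t :: T) prefix_form x) =
    root_deriv u (prefix_form t) * \prod_(x <- T) prefix_form x +
    prefix_form t * root_deriv u (\prod_(x <- T) prefix_form x).
  by rewrite big_cons /root_deriv !mderivM; ring.
rewrite root_deriv_prefix_form // IH [RHS]big_cons /= eqxx; congr (_ + _).
rewrite mulr_sumr big_seq [RHS]big_seq; apply: eq_bigr => t' t'T.
(* If [t'] equals the head, [rem] deletes the head; deleting the copy in the tail leaves the same
   product. *)
rewrite mulrCA; congr (_ * _); case: eqVneq => [->|_]; last by rewrite big_cons.
by rewrite (perm_big _ (perm_to_rem t'T)) big_cons.
Qed.

(** Adjointness moves one root onto the product, where the Leibniz rule matches [u] with each form
    that it covers. Iterated, this counts perfect matchings of [s] with [T]. *)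
Lemma mpair_roots_cons u s T : (u.1 <= u.2)%N ->
  mpair (\prod_(v <- u :: s) root_form v) (\prod_(t <- T) prefix_form t) =
  \sum_(t <- T | covers u t)
    mpair (\prod_(v <- s) root_form v) (\prod_(t' <- rem t T) prefix_form t').
Proof.
move=> le_u; rewrite big_cons mulrC mpair_root root_deriv_prod // raddf_sum [RHS]big_mkcond /=.
by apply: eq_bigr => t _; case: ifP => _; rewrite ?mul1r // mul0r raddf0.
Qed.

Lemma mpair_roots_ge0 s T : all (fun u => u.1 <= u.2)%N s -> size s = size T ->
  0 <= mpair (\prod_(u <- s) root_form u) (\prod_(t <- T) prefix_form t).
Proof.
elim: s T => [|u s IH] T /=.
  by move=> _ /esym/size0nil ->; rewrite !big_nil mpair11 mcoeff1 eqxx.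
case/andP=> le_u le_s sz; rewrite mpair_roots_cons // big_seq_cond sumr_ge0 // => t /andP[tT _].
by apply: IH => //; rewrite size_rem // -sz.
Qed.

(** The matching given by [zip s T] contributes a positive term, and all other terms are
    non-negative. *)
Lemma mpair_roots_gt0 s T : all (fun u => u.1 <= u.2)%N s -> size s = size T ->
    all (fun ut => covers ut.1 ut.2) (zip s T) ->
  0 < mpair (\prod_(u <- s) root_form u) (\prod_(t <- T) prefix_form t).
Proof.
elim: s T => [|u s IH] [|t T] //=.
  by move=> _ _ _; rewrite !big_nil mpair11 mcoeff1 eqxx.
case/andP=> le_u le_s [sz] /andP[ut sT]; rewrite mpair_roots_cons // big_cons /= ut eqxx.
rewrite ltr_pwDl ?IH // big_seq_cond sumr_ge0 // => t' /andP[t'T _].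
apply: mpair_roots_ge0 => //; case: eqVneq => //= _.
by rewrite size_rem // prednK //; case: (T) t'T.
Qed.

End Linear_forms.

(** * A permutation avoiding one prescribed value per upper vertex *)

Lemma prod_root_form n :
  \prod_(u <- enum [pred u : 'I_n * 'I_n | (u.1 <= u.2)%N]) root_form u =
  \prod_(i < n.+1) \prod_(j < n.+1 | (i < j)%N) ('X_i - 'X_j).
Proof.
rewrite big_enum /= [RHS]big_ord_recr /= [X in _ * X]big1 ?mulr1; last first.
  by move=> j; rewrite ltnNge -ltnS ltn_ord.
rewrite -(pair_big_dep xpredT (fun i j : 'I_n => (i <= j)%N) (fun i j => root_form (i, j))) /=.
apply: eq_bigr => i _; rewrite big_mkcond [RHS]big_mkcond big_ord_recl /= mul1r.
by apply: eq_bigr => j _; rewrite /bump leq0n add1n ltnS.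
Qed.

Lemma msize_prod_prefix_form n (T : seq ('I_n * int)) :
  (msize (\prod_(t <- T) prefix_form t) <= (size T).+1)%N.
Proof.
elim: T => [|t T IH]; first by rewrite big_nil msize1.
have sz_t : (msize (prefix_form t) <= 2)%N.
  rewrite /prefix_form; apply: leq_trans (msizeD_le _ _) _.
  rewrite geq_max msizeN msizeC.
  rewrite (leq_trans (leq_b1 _)) // andbT.
  elim/big_rec: _ => [|j p _ sz_p]; first by rewrite msize0.
  by apply: leq_trans (msizeD_le _ _) _; rewrite geq_max sz_p msizeX mdeg1.
rewrite big_cons /=.
have [->|nz_t] := eqVneq (prefix_form t) 0; first by rewrite mul0r msize0.
have [->|nz_T] := eqVneq (\prod_(t <- T) prefix_form t) 0; first by rewrite mulr0 msize0.
by rewrite msizeM // -subn1 leq_subLR (leq_add sz_t IH).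
Qed.

Lemma card_ord_pairs n : #|[pred u : 'I_n * 'I_n | (u.1 <= u.2)%N]| = 'C(n.+1, 2).
Proof.
rewrite -bin2_sum big_mkord big_ord_recl add0n -sum1_card.
rewrite -(pair_big_dep xpredT (fun i j : 'I_n => (i <= j)%N) (fun _ _ => 1%N)) /=.
rewrite (exchange_big_dep xpredT) //=; apply: eq_bigr => j _.
under eq_bigl do rewrite -ltnS.
by rewrite -(big_ord_widen n (fun _ => 1%N) (ltn_ord j)) sum1_card card_ord.
Qed.

(** If [P] vanished at every rearrangement, the signed sum would be 0; but [a] is injective, and the
    alternating coefficient sum is nonzero by positivity of the pairing. *)
Lemma exists_perm_avoiding n (a : 'I_n.+1 -> int) (T : 'I_n * 'I_n -> 'I_n * int) :
    injective a -> (forall u : 'I_n * 'I_n, (u.1 <= u.2)%N -> covers u (T u)) ->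
  exists pi : 'S_n.+1, forall u : 'I_n * 'I_n, (u.1 <= u.2)%N ->
    \sum_(j < n.+1 | (j <= (T u).1)%N) a (pi j) != (T u).2.
Proof.
move=> inj_a covT; pose s := enum [pred u : 'I_n * 'I_n | (u.1 <= u.2)%N].
have s_le : all (fun u : 'I_n * 'I_n => u.1 <= u.2)%N s by apply/allP => u; rewrite mem_enum.
pose P := \prod_(t <- map T s) prefix_form t.
have P_gt0 : 0 < mpair (\prod_(u <- s) root_form u) P.
  apply: mpair_roots_gt0; rewrite ?size_map //.
  rewrite -{1}[s]map_id zip_map all_map; apply/allP => u us /=.
  by apply: covT; apply: (allP s_le).
have szP : (msize P <= 'C(n.+1, 2).+1)%N.
  by rewrite (leq_trans (msize_prod_prefix_form _)) // size_map -cardE card_ord_pairs.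
have [pi Ppi] : exists pi : 'S_n.+1, P.@[fun i => a (pi i)] != 0.
  apply/existsP; apply: contraT => /existsPn h.
  have := sum_sign_meval a szP; rewrite big1 => [|pi _]; last first.
    by have := h pi; rewrite negbK => /eqP ->; rewrite mulr0.
  move/esym/eqP; rewrite mulf_eq0 => /orP[/eqP e|].
    move: P_gt0; rewrite prod_root_form.
    (* Roots are lower index minus higher, opposite to the Vandermonde product; only a sign
       changes. *)
    have -> : \prod_(i < n.+1) \prod_(j < n.+1 | (i < j)%N) ('X_i - 'X_j) =
        (-1) ^+ #|[pred p : 'I_n.+1 * 'I_n.+1 | (p.1 < p.2)%N]| *:
        \prod_(i < n.+1) \prod_(j < n.+1 | (i < j)%N) ('X_j - 'X_i) :> {mpoly int[n.+1]}.
      rewrite -signr_odd scaler_sign -mulr_sign signr_odd.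
      rewrite !pair_big_dep /= -prodrN; apply: eq_bigr => p _.
      by rewrite opprB.
    by rewrite mpairC mpairZr mpairC mpair_vandermonde e !mulr0 ltxx.
  rewrite prodf_seq_eq0 => /hasP[i _ /=]; rewrite prodf_seq_eq0 => /hasP[j _ /andP[ij]].
  by rewrite subr_eq0 => /eqP/inj_a e; rewrite e ltnn in ij.
exists pi => u le_u; apply: contra Ppi => /eqP e.
rewrite /P big_map rmorph_prod prodf_seq_eq0; apply/hasP; exists u; first by rewrite mem_enum.
rewrite /= /prefix_form mevalB mevalC raddf_sum /= -e subr_eq0; apply/eqP.
by apply: eq_bigr => j _; rewrite mevalXU.
Qed.

(** * Hall's marriage theorem *)

Lemma Hall_marriage (T U : finType) (N : T -> {set U}) :
    (forall S : {set T}, #|S| <= #|\bigcup_(x in S) N x|)%N ->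
  exists2 f : T -> U, injective f & forall x, f x \in N x.
(* Rado's argument: while some [N x] has two elements, submodularity of S |-> #|N(S)|
   shows that one of them can be removed without breaking the hypothesis. *)
Proof.
have [m] := ubnP (\sum_x #|N x|)%N; elim: m N => // m IHm N lt_m hallN.
have N1 x : \bigcup_(z in [set x]) N z = N x by rewrite big_set1.
case: (boolP [exists x, 1 < #|N x|]%N) =>
    [/existsP[x /card_gt1P[y1 [y2 [y1N y2N y12]]]]|/existsPn le1].
  pose N' y z := if z == x then N x :\ y else N z.
  have sumN' y : y \in N x -> (\sum_z #|N' y z| < m)%N.
    move=> yN; rewrite -ltnS (leq_trans _ lt_m) // ltnS.
    rewrite (bigD1 x) //= [X in (_ < X)%N](bigD1 x) //= /N' eqxx (cardsD1 y (N x)) yN.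
    rewrite addSn ltnS leq_add2l.
    by apply: leq_sum => z /negPf ->.
  have subN' y z : N' y z \subset N z.
    by rewrite /N'; case: eqP => [->|//]; rewrite subD1set.
  have ext y : y \in N x ->
      (forall S : {set T}, #|S| <= #|\bigcup_(z in S) N' y z|)%N ->
      exists2 f : T -> U, injective f & forall x, f x \in N x.
    move=> yN /(IHm _ (sumN' y yN))[f inj_f fN]; exists f => // z.
    by apply: (subsetP (subN' y z)) (fN z).
  (* A set that violates the condition after [y] is removed must contain [x]; [A] is that set
     without [x]. *)
  have viol y : ~~ [forall S : {set T}, #|S| <= #|\bigcup_(z in S) N' y z|]%N ->
      exists2 A : {set T}, x \notin A &
        (#|(N x :\ y) :|: \bigcup_(z in A) N z| <= #|A|)%N.
    case/forallPn => S; rewrite -ltnNge => ltS.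
    have eN (A : {set T}) : x \notin A -> \bigcup_(z in A) N' y z = \bigcup_(z in A) N z.
      move=> xA; apply: eq_bigr => z zA; rewrite /N'; case: eqP => // zx.
      by rewrite zx (negPf xA) in zA.
    have [xS|xS] := boolP (x \in S); last first.
      by move: ltS; rewrite eN // ltnNge hallN.
    exists (S :\ x); first by rewrite !inE eqxx.
    move: ltS; rewrite (big_setD1 x) //= eN ?inE ?eqxx // /N' eqxx.
    by rewrite (cardsD1 x S) xS.
  case: (boolP [forall S : {set T}, #|S| <= #|\bigcup_(z in S) N' y1 z|]%N) => [/forallP|].
    exact: ext.
  case/viol => A1 xA1 le_1.
  case: (boolP [forall S : {set T}, #|S| <= #|\bigcup_(z in S) N' y2 z|]%N) => [/forallP|].
    exact: ext.
  case/viol => A2 xA2 le_2; exfalso.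
  set B1 := _ :|: _ in le_1; set B2 := _ :|: _ in le_2.
  (* Since [y1] and [y2] differ, [B1 :|: B2] contains all of [N x]. Adding this bound to the one for
     intersections gives #|A1| + #|A2| + 1 <= #|B1| + #|B2|, against [le_1] and [le_2]. *)
  have leU : (#|x |: (A1 :|: A2)| <= #|B1 :|: B2|)%N.
    apply: leq_trans (hallN _) _; apply: subset_leq_card; apply/bigcupsP => z.
    rewrite !inE => /or3P[/eqP->|zA|zA].
    - apply/subsetP => y yN; rewrite !inE yN !andbT.
      by case: (eqVneq y y1) => [->|]; rewrite ?y12 ?orbT.
    - by rewrite (subset_trans _ (subsetUl _ _)) // (subset_trans _ (subsetUr _ _)) // bigcup_sup.
    - by rewrite (subset_trans _ (subsetUr _ _)) // (subset_trans _ (subsetUr _ _)) // bigcup_sup.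
  have leI : (#|A1 :&: A2| <= #|B1 :&: B2|)%N.
    apply: leq_trans (hallN _) _; apply: subset_leq_card; apply/bigcupsP => z.
    rewrite inE => /andP[zA1 zA2]; rewrite subsetI.
    by rewrite !(subset_trans _ (subsetUr _ _)) // bigcup_sup.
  move: leU; rewrite cardsU1 inE negb_or xA1 xA2 /= => leU.
  have := cardsUI A1 A2; have := cardsUI B1 B2; lia.
(* Now each [N x] is a singleton, and the hypothesis on pairs makes the choice injective. *)
have fP x : {y | y \in N x}.
  apply: sigW; apply/set0Pn; rewrite -card_gt0.
  by have := hallN [set x]; rewrite N1 cards1.
exists (fun x => sval (fP x)) => [x y|x]; last by case: (fP x).
case: (fP x) (fP y) => u uN [v vN] /= uv; apply/eqP; apply: contraT => xy.
have eN z w : w \in N z -> N z = [set w].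
  move=> wN; apply/esym/eqP; rewrite eqEcard sub1set wN cards1.
  by rewrite leqNgt le1.
have := hallN [set x; y]; rewrite cards2 xy big_setU1 ?inE //= big_set1.
by rewrite (eN _ _ uN) (eN _ _ vN) uv setUid cards1.
Qed.

(** * Counting intervals, and Hall's condition from admissibility *)

Lemma card_ord_lt n r : (r <= n)%N -> #|[set l : 'I_n | (l < r)%N]| = r.
Proof.
move=> le_r; rewrite cardsE -sum1_card -(big_ord_widen n (fun _ => 1%N) le_r).
by rewrite sum1_card card_ord.
Qed.

Lemma card_ord_interval n p r : (p <= r <= n)%N ->
  #|[set l : 'I_n | (p <= l < r)%N]| = (r - p)%N.
Proof.
case/andP=> le_pr le_rn.
have -> : [set l : 'I_n | (p <= l < r)%N] =
    [set l : 'I_n | (l < r)%N] :\: [set l : 'I_n | (l < p)%N].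
  by apply/setP => l; rewrite !inE -leqNgt.
rewrite cardsD card_ord_lt // (setIidPr _) ?card_ord_lt ?(leq_trans le_pr) //.
by apply/subsetP => l; rewrite !inE => /leq_trans; apply.
Qed.

Lemma bin2D x y : 'C(x + y, 2) = ('C(x, 2) + 'C(y, 2) + x * y)%N.
Proof. elim: y => [|y IH]; rewrite ?addn0 ?muln0 ?addn0 // addnS !binS !bin1 IH; lia. Qed.

Lemma sum_perm_geq n (pi : 'S_n) (A : {set 'I_n}) : ('C(#|A|, 2) <= \sum_(j in A) pi j)%N.
Proof.
pose s := [seq (pi j : nat) | j <- enum A].
have us : uniq s by rewrite map_inj_uniq ?enum_uniq // => i j /val_inj/perm_inj.
have := uniq_sumn_geq us.
by rewrite size_map -cardE sumnE big_map big_enum.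
Qed.

Section Necessity.
Variables (n : nat) (b : 'I_n -> nat) (I : {set 'I_n}).

Definition meets (u : 'I_n * 'I_n) := [exists i in I, (u.1 <= i <= u.2)%N].
Let W r := #|[set u : 'I_n * 'I_n | meets u && (u.2 < r)%N]|.
Let B r := (\sum_(i in I | (i < r)%N) b i)%N.

(** Intervals with left end at most [p] and right end in [p, r-1] contain [p], hence meet [I], and
    [W p] does not count them. Indices start at 0, so there are p + 1 left ends. *)
Lemma card_meets_step (p : 'I_n) r : p \in I -> (p <= r <= n)%N ->
  (W p + p.+1 * (r - p) <= W r)%N.
Proof.
move=> pI pr; pose X := setX [set j : 'I_n | (j < p.+1)%N] [set l : 'I_n | (p <= l < r)%N].
have -> : (p.+1 * (r - p))%N = #|X| by rewrite cardsX card_ord_lt // card_ord_interval.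
rewrite /W -cardsUI [X in (_ + X)%N](_ : _ = 0)%N ?addn0; last first.
  apply/eqP; rewrite cards_eq0; apply/eqP/setP => u; rewrite !inE.
  by case: (ltnP u.2 p) => ?; rewrite ?andbF.
apply/subset_leq_card/subsetP => u; rewrite !inE => /orP[/andP[-> lt_u]|].
  by rewrite (leq_trans lt_u) //; case/andP: pr.
case/and3P=> up pu ->; rewrite andbT; apply/existsP; exists p.
by rewrite pI pu andbT.
Qed.

Lemma sum_max_below (p : 'I_n) r : p \in I -> (p < r)%N ->
  (forall q : 'I_n, q \in I -> (q < r)%N -> (q <= p)%N) -> B r = (B p + b p)%N.
Proof.
move=> pI pr pmax; rewrite /B (bigD1 p) ?pI //= addnC; congr (_ + _)%N.
apply: eq_bigl => q; rewrite -andbA; case qI: (q \in I) => //=.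
apply/andP/idP => [[qr qp]|qp]; first by rewrite ltn_neqAle pmax // andbT.
by rewrite (ltn_trans qp pr) //; split => //; apply: contraTneq qp => ->; rewrite ltnn.
Qed.

Lemma max_belowP r : (exists2 p, p \in I & (p < r)%N /\ B r = B p + b p)%N \/ B r = 0%N.
Proof.
case: (pickP [pred p in I | (p < r)%N]) => [p0 p0P|no]; last first.
  by right; rewrite /B big_pred0.
left; case: (@arg_maxnP _ p0 [pred p in I | (p < r)%N] (@nat_of_ord n) p0P) => p /andP[pI pr] pmax.
exists p => //; split => //; apply: sum_max_below => // q qI qr.
by apply: pmax; rewrite inE qI.
Qed.

Hypothesis adm : @admissible n.+1 b.

Lemma admissible_sum_leq : (\sum_(i in I) b i <= #|[set u | meets u]|)%N.
Proof.
(* The interval [M i] may start below every partial sum, which wastes some values. *)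
pose c i : int := 'C(i.+1, 2)%:Z + (B i)%:Z - (W i)%:Z.
pose M (i : 'I_n) := [seq c i + t%:Z | t <- iota 0 (b i)].
have Mb i : uniq (M i) /\ size (M i) = b i.
  by rewrite size_map size_iota map_inj_uniq ?iota_uniq // => x y /addrI[].
have inj_a : injective (fun j : 'I_n.+1 => j%:Z) by move=> i j [/val_inj].
have [pi piM] := adm inj_a Mb.
pose S i := (\sum_(j < n.+1 | (j <= i)%N) pi j)%N.
have Sgeq p r : (p <= r <= n)%N ->
    (\sum_(j < n.+1 | p < j <= r) pi j >= 'C(r - p, 2))%N.
  move=> /andP[pr rn]; have := sum_perm_geq pi [set j : 'I_n.+1 | (p.+1 <= j < r.+1)%N].
  rewrite card_ord_interval ?ltnS ?pr // subSS => /leq_trans; apply.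
  by rewrite big_set.
(* This says c i + b i <= S i, with [W i] moved across to stay in [nat]: avoiding [M i] pushes the
   partial sum past the end of the interval. *)
have key (i : 'I_n) : i \in I -> ('C(i.+1, 2) + B i + b i <= S i + W i)%N.
  have [m] := ubnP i; elim: m i => // m IHm i lt_i iI.
  have le_c : ('C(i.+1, 2) + B i <= S i + W i)%N.
    have [[p pI [pi_lt ->]]|->] := max_belowP i; last first.
      have := sum_perm_geq pi [set j : 'I_n.+1 | (j < i.+1)%N].
      rewrite card_ord_lt; last by rewrite ltnS ltnW.
      by rewrite big_set addn0 => /leq_trans; apply; rewrite leq_addr.
    have := IHm p (leq_trans pi_lt _) pI; rewrite -ltnS => /(_ lt_i) IHp.
    have Wp : (W p + p.+1 * (i - p) <= W i)%N.
      by apply: card_meets_step => //; rewrite ltnW //= ltnW.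
    (* By [bin2D] the minimum splits into C(p+1,2), C(i-p,2) and the cross term (p+1)(i-p), which
       the growth from [W p] to [W i] pays for. *)
    have -> : i.+1 = (p.+1 + (i - p))%N by rewrite addSn subnKC // ltnW.
    have Si : S i = (S p + \sum_(j < n.+1 | p < j <= i) pi j)%N.
      rewrite /S (bigID (fun j : 'I_n.+1 => j <= p)%N) /=.
      by congr (_ + _)%N; apply: eq_bigl => j; lia.
    have := Sgeq p i; rewrite ltnW // (ltnW (ltn_ord i)) => /(_ isT).
    rewrite Si bin2D; lia.
  (* Otherwise c i <= S i < c i + b i, and [S i] is the entry of [M i] at offset S i - c i. *)
  have := piM i; apply: contraR; rewrite -ltnNge => lt_c.
  apply/mapP; exists (S i + W i - ('C(i.+1, 2) + B i))%N; first by rewrite mem_iota; lia.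
  have -> : \sum_(j < n.+1 | (j <= i)%N) (pi j)%:Z = (S i)%:Z 
    by rewrite -[RHS]natz /S natr_sum; apply: eq_bigr => j _; rewrite natz.
  by rewrite /c -subzn //; lia.
have -> : (\sum_(i in I) b i = B n)%N by apply: eq_bigl => i; rewrite ltn_ord andbT.
have -> : [set u | meets u] = [set u : 'I_n * 'I_n | meets u && (u.2 < n)%N].
  by apply/setP => u; rewrite !inE ltn_ord andbT.
rewrite -/(W n); have [[p pI [pn ->]]|->//] := max_belowP n.
have := key p pI; have := @card_meets_step p n pI; rewrite (ltnW pn) leqnn => /(_ isT).
have := Sgeq p n; rewrite (ltnW pn) leqnn => /(_ isT).
(* The total is fixed, so the last n - p values, summing to at least C(n-p,2), bound [S p] from
   above; with [key] this gives B n <= W n. *)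
have St : (S p + \sum_(j < n.+1 | p < j <= n) pi j = 'C(n.+1, 2))%N.
  rewrite -bin2_sum big_mkord [RHS](reindex_inj (@perm_inj _ pi)).
  rewrite [RHS](bigID (fun j : 'I_n.+1 => j <= p)%N) /=; congr (_ + _)%N; apply: eq_bigl => j.
  by rewrite -ltnNge leq_ord andbT.
have : 'C(n.+1, 2) = 'C(p.+1 + (n - p), 2) by rewrite addSn subnKC // ltnW.
rewrite bin2D; lia.
Qed.

End Necessity.

(** * The two implications *)

Lemma admissible_matching n (b : 'I_n -> nat) : @admissible n.+1 b -> @matching_seq n.+1 b.
Proof.
move=> adm; pose T := {i : 'I_n & 'I_(b i)}.
pose N (x : T) := [set u : 'I_n * 'I_n | (u.1 <= tag x <= u.2)%N].
have hallN (S : {set T}) : (#|S| <= #|\bigcup_(x in S) N x|)%N.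
  (* The neighbourhood of [S] depends only on its indices, so the worst case takes all [b i] lower
     vertices for each [i] in [I]. *)
  pose I := [set tag x | x in S].
  have -> : \bigcup_(x in S) N x = [set u | meets I u].
    apply/setP => u; rewrite inE; apply/bigcupP/existsP => [[x xS]|[i /andP[/imsetP[x xS ->] xu]]].
      by rewrite inE => xu; exists (tag x); rewrite imset_f.
    by exists x; rewrite ?inE.
  apply: leq_trans (admissible_sum_leq I adm).
  rewrite -sum1_card (partition_big tag (mem I)) /= => [|x xS]; last by rewrite imset_f.
  apply: leq_sum => i _; rewrite sum1_card.
  rewrite -[X in (_ <= X)%N]card_ord.
  apply: leq_trans (leq_image_card (Tagged (fun i => 'I_(b i))) predT).
  apply/subset_leq_card/subsetP => -[i' t] /andP[_ /eqP /= ei].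
  by subst i'; apply: codom_f.
have [f inj_f fN] := Hall_marriage hallN.
exists (fun i t => f (Tagged (fun i => 'I_(b i)) t)); split => [i t|i1 t1 i2 t2 /inj_f e].
  by have := fN (Tagged (fun i => 'I_(b i)) t); rewrite inE.
have e1 := congr1 tag e; rewrite /= in e1; subst i2.
by split => //; move/eqP: e; rewrite eq_Tagged /= => /eqP ->.
Qed.

Lemma matching_admissible n (b : 'I_n -> nat) : @matching_seq n.+1 b -> @admissible n.+1 b.
Proof.
case=> f [f_adj f_inj] a inj_a M Mb.
pose F (x : {i : 'I_n & 'I_(b i)}) := f (tag x) (tagged x).
(* Unmatched upper vertices get the harmless extra factor x_1+...+x_(u.1). *)
pose T u := if [pick x | F x == u] is Some x then (tag x, nth 0 (M (tag x)) (tagged x))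
            else (u.1, 0).
have covT (u : 'I_n * 'I_n) : (u.1 <= u.2)%N -> covers u (T u).
  move=> le_u; rewrite /T; case: pickP => [x /eqP <-|_]; first exact: f_adj.
  by rewrite /covers leqnn.
have [pi piT] := exists_perm_avoiding inj_a covT.
exists pi => i; apply/negP => inM; have [_ szM] := Mb i.
have lt_t : (index (\sum_(j < n.+1 | (j <= i)%N) a (pi j))%R (M i) < b i)%N.
  by rewrite -szM index_mem.
pose t := Ordinal lt_t.
have le_u : ((f i t).1 <= (f i t).2)%N by case/andP: (f_adj i t); apply: leq_trans.
(* Injectivity of [f] forces the picked lower vertex to be (i, t), so the value avoided at [f i t]
   is the supposed partial sum itself. *)
have := piT _ le_u; rewrite /T; case: pickP => [[i' t'] /eqP/f_inj[/= ei et]|].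
  by subst i'; rewrite et nth_index // eqxx.
by move/(_ (Tagged (fun i => 'I_(b i)) t)); rewrite /F eqxx.
Qed.

Theorem mainTheorem5 (k : nat) (hk : (2 <= k)%N) (b : 'I_k.-1 -> nat) :
  admissible b <-> matching_seq b.
Proof.
case: k hk b => // n _ b.
split; [exact: admissible_matching | exact: matching_admissible].
Qed.
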